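(* For integers $a,b\ge 1$ let $\mathrm{CC}_{a,b}$ be the cycle-chord graph and $X_{\mathrm{CC}_{a,b}}$ its chromatic symmetric function. Then \[ \sum_{a,b\ge1}X_{\mathrm{CC}_{a,b}}\,x^ay^b =\frac{xy}{(x-y)^2}\left[ \frac{x^2E''(x)E(y)+y^2E''(y)E(x)}{F(x)F(y)} -\frac{2xy}{x-y}\left( \frac{E'(x)}{F(x)}-\frac{E'(y)}{F(y)}\right)\right], \] where $E(z)=\sum_{n\ge0}e_nz^n$ and $F(z)=E(z)-zE'(z)$.
   Context: For a finite simple graph $G$, the chromatic symmetric function is $X_G=\sum_\kappa\prod_{v\in V(G)}x_{\kappa(v)}$, where $x_1,x_2,\dots$ are commuting indeterminates and the sum is over all proper colorings $\kappa\colon V(G)\to\{1,2,3,\dots\}$. Here $e_n=\sum_{1\le i_1<\dots<i_n}x_{i_1}\dotsm x_{i_n}$ are the elementary symmetric functions, with $e_0=1$; primes denote formal derivatives with respect to $z$. The identity is one of formal power series in the two further indeterminates $x,y$ with coefficients in the ring of symmetric functions (after clearing the powers of $x-y$ in the denominators). The cycle-chord graph $\mathrm{CC}_{a,b}$ ($a,b\ge1$) is obtained by identifying an edge of the cycle $C_{a+1}$ with an edge of the cycle $C_{b+1}$. Explicitly, it has $a+b$ vertices $v_0,v_1,\dots,v_{a+b-1}$, and its edges are those of the cycle $v_0v_1\dotsm v_{a+b-1}v_0$ together with $v_0v_a$. Multiple edges are regarded as single edges (they do not affect proper colorings); thus $\mathrm{CC}_{1,b}=C_{b+1}$ and $\mathrm{CC}_{a,1}=C_{a+1}$,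 where $C_2$ is a single edge on two vertices. *)

(* Defs.v *)
From HB Require Import structures.
From mathcomp Require Import all_boot all_order all_algebra.
From mathcomp Require Import finmap multiset.
From mathcomp Require Import boolp classical_sets functions cardinality fsbigop.

Set Implicit Arguments.
Unset Strict Implicit.
Unset Printing Implicit Defensive.

Import GRing.Theory.
Local Open Scope ring_scope.

(* Additive monoids of exponents, in which every element has only finitely many
   decompositions as a sum of two, so that the Cauchy product makes sense. *)
HB.mixin Record Nmodule_isFinDecomp M of GRing.Nmodule M := {
  finite_decomp : forall m : M,
    finite_set [set p : M * M | p.1 + p.2 = m]%classic
}.

#[short(type="expoType")]
HB.structure Definition FinDecomp := {M of GRing.Nmodule M & Nmodule_isFinDecomp M}.

Section Decomp.
Variable M : expoType.

Definition decomp (m : M) : {fset M * M} :=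
  fset_set [set p : M * M | p.1 + p.2 = m]%classic.

Lemma mem_decomp m p : (p \in decomp m) = (p.1 + p.2 == m).
Proof.
rewrite /decomp in_fset_set; last exact: finite_decomp.
by apply/idP/eqP; rewrite inE.
Qed.

End Decomp.

(* Formal power series over R whose monomials are the elements of M, written
   additively (as exponents): [f m] is the coefficient of the monomial m. *)
Record fps (R : Type) (M : Type) := FPS { fcoef :> M -> R }.
Arguments FPS {R M} fcoef.

HB.instance Definition _ R M := gen_eqMixin (fps R M).
HB.instance Definition _ R M := gen_choiceMixin (fps R M).

Lemma fpsP (R M : Type) (f g : fps R M) : f =1 g -> f = g.
Proof. by case: f g => f [g] /= /funext ->. Qed.

Section Zmod.
Variables (R : comNzRingType) (M : expoType).
Implicit Types f g h : fps R M.

Definition fps_zero : fps R M := FPS (fun _ => 0).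
Definition fps_opp f : fps R M := FPS (fun m => - f m).
Definition fps_add f g : fps R M := FPS (fun m => f m + g m).

Fact fps_addA : associative fps_add.
Proof. by move=> f g h; apply: fpsP => m /=; rewrite addrA. Qed.
Fact fps_addC : commutative fps_add.
Proof. by move=> f g; apply: fpsP => m /=; rewrite addrC. Qed.
Fact fps_add0 : left_id fps_zero fps_add.
Proof. by move=> f; apply: fpsP => m /=; rewrite add0r. Qed.
Fact fps_addN : left_inverse fps_zero fps_opp fps_add.
Proof. by move=> f; apply: fpsP => m /=; rewrite addNr. Qed.

HB.instance Definition _ :=
  GRing.isZmodule.Build (fps R M) fps_addA fps_addC fps_add0 fps_addN.

Definition fps_monom (m : M) : fps R M := FPS (fun n => (n == m)%:R).

Definition fps_mul f g : fps R M :=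
  FPS (fun m => \sum_(p <- decomp m) f p.1 * g p.2).

Fact fps_mulC : commutative fps_mul.
Proof.
move=> f g; apply: fpsP => m /=.
have swap_inj : injective (fun p : M * M => (p.2, p.1)).
  by move=> [a b] [c d] /= [-> ->].
have sw : perm_eq (decomp m) [seq (p.2, p.1) | p <- decomp m].
  apply: uniq_perm => [||p]; first exact: fset_uniq.
    by rewrite map_inj_uniq ?fset_uniq.
  apply/idP/mapP => [|[q]]; rewrite mem_decomp => /eqP pm.
    by exists (p.2, p.1); rewrite ?mem_decomp /= 1?addrC ?pm //; case: (p).
  by move=> ->; rewrite mem_decomp /= addrC pm.
by rewrite (perm_big _ sw) big_map; apply: eq_bigr => p _; rewrite mulrC.
Qed.

Fact fps_mul1 : left_id (fps_monom 0) fps_mul.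
Proof.
move=> f; apply: fpsP => m /=.
rewrite (bigD1_seq (0, m)) ?fset_uniq ?mem_decomp /= ?add0r ?eqxx //= mul1r.
rewrite big_seq_cond big1 ?addr0 // => -[a b] /=.
rewrite mem_decomp /= => /andP[/eqP <-]; case: (eqVneq a 0) => [->|].
  by rewrite add0r eqxx.
by rewrite mul0r.
Qed.

Fact fps_mulA : associative fps_mul.
Proof.
move=> f g h; apply: fpsP => m /=.
pose T (t : M * M * M) := f t.1.1 * g t.1.2 * h t.2.
transitivity (\sum_(t <- [seq ((p.1, q.1), q.2) | p <- decomp m, q <- decomp p.2]) T t).
  rewrite big_allpairs_dep; apply: eq_bigr => p _.
  by rewrite big_distrr /=; apply: eq_bigr => q _; rewrite mulrA.
transitivity (\sum_(t <- [seq (q, p.2) | p <- decomp m, q <- decomp p.1]) T t); last first.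
  by rewrite big_allpairs_dep; apply: eq_bigr => p _; rewrite big_distrl.
apply/perm_big/uniq_perm.
- apply: allpairs_uniq_dep => [||[[a b] [c d]] [[a' b'] [c' d']] /=].
  + exact: fset_uniq.
  + by move=> *; exact: fset_uniq.
  move=> /allpairsPdep[u [v [_ +]]] => vu [? ?]; subst.
  move=> /allpairsPdep[u' [v' [_ +]]] => vu' [? ?]; subst.
  move: vu vu'; rewrite !mem_decomp /= => /eqP <- /eqP <-.
  by move=> [-> -> ->].
- apply: allpairs_uniq_dep => [||[[a b] [c d]] [[a' b'] [c' d']] /=].
  + exact: fset_uniq.
  + by move=> *; exact: fset_uniq.
  move=> /allpairsPdep[u [v [_ +]]] => vu [? ?]; subst.
  move=> /allpairsPdep[u' [v' [_ +]]] => vu' [? ?]; subst.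
  move: vu vu'; rewrite !mem_decomp /= => /eqP <- /eqP <-.
  by move=> [-> -> ->].
move=> [[a b] c]; apply/allpairsPdep/allpairsPdep => /= -[[p1 p2] [[q1 q2] []]] /=;
  rewrite !mem_decomp /= => /eqP <- /eqP <- [-> -> ->].
  by exists (p1 + q1, q2), (p1, q1); rewrite !mem_decomp /= addrA !eqxx.
by exists (q1, q2 + p2), (q2, p2); rewrite !mem_decomp /= addrA !eqxx.
Qed.

Fact fps_mulD : left_distributive fps_mul +%R.
Proof.
move=> f g h; apply: fpsP => m /=.
by rewrite -big_split; apply: eq_bigr => p _; rewrite /= mulrDl.
Qed.

Fact fps_one_neq0 : fps_monom 0 != 0.
Proof.
apply/eqP => /(congr1 (fun f : fps R M => f 0)) /=.
by rewrite eqxx => /eqP; rewrite oner_eq0.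
Qed.

HB.instance Definition _ := GRing.Zmodule_isComNzRing.Build (fps R M)
  fps_mulA fps_mulC fps_mul1 fps_mulD fps_one_neq0.

(* Units and inverses are chosen classically; [Fser_x_unit] and [Fser_y_unit]
   below show that F(x) and F(y) are units, so that quotients by them are
   genuine. *)
Definition fps_unit : pred (fps R M) := [pred f | `[< exists g, g * f = 1 >]].
Definition fps_inv f : fps R M :=
  if pselect (exists g, g * f = 1) is left h then projT1 (cid h) else f.

Fact fps_mulV : {in fps_unit, left_inverse 1 fps_inv *%R}.
Proof.
move=> f /asboolP uf; rewrite /fps_inv.
by case: pselect => // h; case: (cid h).
Qed.
Fact fps_unitP f g : g * f = 1 -> fps_unit f.
Proof. by move=> gf1; apply/asboolP; exists g. Qed.
Fact fps_inv_out : {in [predC fps_unit], fps_inv =1 id}.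
Proof.
move=> f; rewrite inE /= => /asboolP nuf; rewrite /fps_inv.
by case: pselect.
Qed.

HB.instance Definition _ := GRing.ComNzRing_hasMulInverse.Build (fps R M)
  fps_mulV fps_unitP fps_inv_out.

Lemma fps_monomD m n : fps_monom (m + n) = fps_monom m * fps_monom n.
Proof.
apply: fpsP => k /=; have [->|kmn] := eqVneq k (m + n).
  rewrite (bigD1_seq (m, n)) ?fset_uniq ?mem_decomp //= !eqxx mulr1.
  rewrite big1 ?addr0 // => -[a b] /=; rewrite xpair_eqE negb_and.
  by case/orP => /negPf ->; rewrite ?mul0r ?mulr0.
rewrite big_seq big1 // => -[a b]; rewrite mem_decomp /= => /eqP abk.
have [am|] := eqVneq a m; last by rewrite mul0r.
have [bn|] := eqVneq b n; last by rewrite mulr0.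
by case/eqP: kmn; rewrite -abk am bn.
Qed.

Lemma fps_monom_sum (I : finType) (F : I -> M) :
  fps_monom (\sum_i F i) = \prod_i fps_monom (F i).
Proof. by apply: (big_morph _ fps_monomD). Qed.

(* The formal sum of a family: every coefficient is the sum of the coefficients
   of the members. As [\sum_(i \in D)] of the library returns 0 when infinitely
   many terms are nonzero, this is only meaningful for a [summable] family. *)
Definition summable (I : choiceType) (D : set I) (f : I -> fps R M) :=
  forall m, finite_set [set i | D i /\ f i m != 0]%classic.

Definition fps_sum (I : choiceType) (D : set I) (f : I -> fps R M) : fps R M :=
  FPS (fun m => \sum_(i \in D) f i m).

End Zmod.

Fact nat_finite_decomp (n : nat) :
  finite_set [set p : nat * nat | p.1 + p.2 = n]%classic.
Proof.
apply: (@sub_finite_set _ _ [set` [seq (i, j) | i <- iota 0 n.+1, j <- iota 0 n.+1]]).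
  move=> [i j] <-; apply/allpairsP; exists (i, j).
  by rewrite !mem_iota /= !ltnS leq_addr leq_addl.
exact: finite_seq.
Qed.
HB.instance Definition _ := Nmodule_isFinDecomp.Build nat nat_finite_decomp.

Fact pair_finite_decomp (M N : expoType) (m : M * N) :
  finite_set [set p : (M * N) * (M * N) | p.1 + p.2 = m]%classic.
Proof.
apply: (@sub_finite_set _ _ [set` [seq ((u.1, v.1), (u.2, v.2)) |
          u <- decomp m.1, v <- decomp m.2]]).
  move=> [[a b] [c d]] /= <-; apply/allpairsP; exists ((a, c), (b, d)).
  by rewrite !mem_decomp /= !eqxx.
exact: finite_seq.
Qed.
HB.instance Definition _ (M N : expoType) :=
  Nmodule_isFinDecomp.Build (M * N)%type (@pair_finite_decomp M N).

(* Commutative monomials in indeterminates indexed by K are multisets over K,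
   their product being the sum of multisets. *)
Section Multiset.
Variable K : choiceType.

HB.instance Definition _ := Choice.on {mset K}%mset.
HB.instance Definition _ := GRing.isNmodule.Build {mset K}%mset
  (@msetDA K) (@msetDC K) (@mset0D K).

Fact mset_finite_decomp (m : {mset K}%mset) :
  finite_set [set p : {mset K}%mset * {mset K}%mset | p.1 + p.2 = m]%classic.
Proof.
pose A := range (fun t : (size m).-tuple bool => seq_mset (mask t m)).
have inA (a : {mset K}%mset) : (forall i, (a i <= m i)%N) -> A a.
  move=> le_am; have /count_subseqP[s] : forall i, (count_mem i a <= count_mem i m)%N.
    by move=> i; rewrite !count_mem_mset.
  move=> /subseqP[t /eqP sz_t def_s] /eq_seq_msetP; rewrite seq_mset_id => eq_a.
  by exists (Tuple sz_t) => //=; rewrite -def_s -eq_a.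
apply: (@sub_finite_set _ _ (A `*` A)%classic).
  move=> [a b] /= def_m; split; apply: inA => i; rewrite -def_m msetE2.
    exact: leq_addr.
  exact: leq_addl.
by apply: finite_setX; apply: finite_image; exact: finite_finset.
Qed.
HB.instance Definition _ := Nmodule_isFinDecomp.Build {mset K}%mset mset_finite_decomp.

End Multiset.

(* Colours and indeterminates are numbered from 0: the index i : nat stands for
   the (i+1)-st indeterminate x_(i+1). *)
Notation xmonom := {mset nat}%mset.

(* The ring of formal power series with integer coefficients in infinitely many
   commuting indeterminates. The ring of symmetric functions is the subring of
   symmetric series of bounded degree; it contains [elemsym n] and
   [chromsym G] below, and an identity between series with coefficients in the
   subring is the same as an identity over the whole ring. *)
Notation xseries := (fps int xmonom).

Definition xvar (i : nat) : xseries := fps_monom int [mset i]%mset.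

Record sgraph := SGraph {
  vertex :> finType;
  adj : rel vertex;
  adj_sym : symmetric adj;
  adj_irr : irreflexive adj
}.

Definition proper_coloring (G : sgraph) (k : {ffun G -> nat}) : Prop :=
  forall u v : G, adj u v -> k u != k v.

Lemma xvar_prodE (I : finType) (c : I -> nat) (m : xmonom) :
  (\prod_i xvar (c i) : xseries) m != 0 -> forall i, c i \in m.
Proof.
rewrite -fps_monom_sum /=; have [-> _ i|_] := eqVneq m; last by rewrite eqxx.
by rewrite (bigD1 i) //= in_msetD in_mset1 eqxx.
Qed.

Definition chromsym (G : sgraph) : xseries :=
  fps_sum [set k : {ffun G -> nat} | proper_coloring k]%classic
    (fun k => \prod_(v : G) xvar (k v)).

(* the families summed in [chromsym] and [elemsym] are summable *)
Lemma chromsym_summable (G : sgraph) :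
  summable [set k : {ffun G -> nat} | proper_coloring k]%classic
    (fun k => \prod_(v : G) xvar (k v)).
Proof.
move=> m; pose B := (\max_(i <- (m : xmonom)) i).+1.
apply: (@sub_finite_set _ _ (range (fun k : {ffun G -> 'I_B} => [ffun v => val (k v)]))).
  move=> k [_ /xvar_prodE km].
  have lt_kB v : (k v < B)%N by rewrite ltnS; apply: leq_bigmax_seq.
  exists [ffun v => Ordinal (lt_kB v)] => //.
  by apply/ffunP => v; rewrite !ffunE.
by apply: finite_image; exact: finite_finset.
Qed.

Definition elemsym (n : nat) : xseries :=
  fps_sum [set i : n.-tuple nat | sorted ltn i]%classic
    (fun i => \prod_(j < n) xvar (tnth i j)).

Lemma elemsym_summable (n : nat) :
  summable [set i : n.-tuple nat | sorted ltn i]%classic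
    (fun i => \prod_(j < n) xvar (tnth i j)).
Proof.
move=> m; pose B := (\max_(i <- (m : xmonom)) i).+1.
apply: (@sub_finite_set _ _ (range (fun i : n.-tuple 'I_B => map_tuple val i))).
  move=> i [_ /xvar_prodE im].
  have lt_iB j : (tnth i j < B)%N by rewrite ltnS; apply: leq_bigmax_seq.
  exists [tuple Ordinal (lt_iB j) | j < n] => //.
  by apply: eq_from_tnth => j; rewrite tnth_map tnth_mktuple.
by apply: finite_image; exact: finite_finset.
Qed.

Lemma elemsym0 : elemsym 0 = 1.
Proof.
apply: fpsP => m /=; rewrite (_ : mkset _ = [set [tuple]]%classic); last first.
  by apply/seteqP; split => i //= _; rewrite (tuple0 i).
by rewrite fsbig_set1 big_ord0.
Qed.

(* the cycle v_0 v_1 ... v_(a+b-1) v_0 with the chord v_0 v_a; adjacency being a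
   relation, multiple edges are merged *)
Definition cc_adj (a b : nat) : rel 'I_(a + b) :=
  fun i j => (i != j) &&
    [|| val j == i.+1 %% (a + b), val i == j.+1 %% (a + b),
        (val i == 0) && (val j == a) | (val j == 0) && (val i == a)]%N.

Fact cc_adj_sym a b : symmetric (@cc_adj a b).
Proof.
move=> i j; rewrite /cc_adj eq_sym; congr (_ && _).
by rewrite orbCA; congr [|| _, _ | _]; rewrite orbC.
Qed.

Fact cc_adj_irr a b : irreflexive (@cc_adj a b).
Proof. by move=> i; rewrite /cc_adj eqxx. Qed.

Definition CC (a b : nat) : sgraph := SGraph (@cc_adj_sym a b) (@cc_adj_irr a b).

(* Univariate series: the exponent n : nat stands for z^n. *)
Section Univariate.
Variable R : comNzRingType.
Implicit Types A B : fps R nat.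

Definition zvar : fps R nat := fps_monom R 1%N.

Definition fps_deriv A : fps R nat := FPS (fun n => A n.+1 *+ n.+1).

(* Bivariate series: the exponent (i, j) : nat * nat stands for x^i y^j. *)
Definition xind : fps R (nat * nat)%type := fps_monom R (1, 0)%N.
Definition yind : fps R (nat * nat)%type := fps_monom R (0, 1)%N.

(* A(x) and A(y), as series in both x and y *)
Definition at_x A : fps R (nat * nat)%type :=
  FPS (fun p => if p.2 == 0%N then A p.1 else 0).
Definition at_y A : fps R (nat * nat)%type :=
  FPS (fun p => if p.1 == 0%N then A p.2 else 0).

Lemma fps_mul_nat A B n : (A * B) n = \sum_(i < n.+1) A i * B (n - i)%N.
Proof.
pose h (i : 'I_n.+1) := (val i, n - i)%N.
have dn : perm_eq (decomp n) [seq h i | i <- enum 'I_n.+1].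
  apply: uniq_perm => [||[a b]]; first exact: fset_uniq.
    by rewrite map_inj_uniq ?enum_uniq // => i j [/val_inj].
  rewrite mem_decomp; apply/eqP/mapP => [abn|[i _ [-> ->]]] /=.
    have lt_a : (a < n.+1)%N by rewrite -abn ltnS leq_addr.
    by exists (Ordinal lt_a); rewrite ?mem_enum // /h /= -abn addKn.
  by rewrite -[LHS]/(i + (n - i))%N subnKC // -ltnS.
by rewrite /= (perm_big _ dn) big_map big_enum.
Qed.

Lemma fps_unit_nat A : A 0%N = 1 -> A \is a GRing.unit.
Proof.
move=> A0; pose step (s : seq R) := rcons s (- \sum_(i < size s) s`_i * A (size s - i)%N).
pose b n := iter n step [:: 1].
have sz_b n : size (b n) = n.+1 by elim: n => //= n IHn; rewrite size_rcons IHn.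
have nth_b n k i : (i <= n)%N -> (b (n + k)%N)`_i = (b n)`_i.
  move=> le_in; elim: k => [|k IHk]; first by rewrite addn0.
  by rewrite addnS /= nth_rcons sz_b ltnS (leq_trans le_in) ?leq_addr.
pose B : fps R nat := FPS (fun n => (b n)`_n).
suff BA1 : B * A = 1 by apply/asboolP; exists B.
apply: fpsP => -[|n]; rewrite fps_mul_nat.
  by rewrite big_ord_recl big_ord0 /= A0 mulr1 addr0.
rewrite big_ord_recr subnn A0 mulr1 /= nth_rcons sz_b ltnn eqxx.
rewrite -[RHS]/0; apply/eqP; rewrite subr_eq0; apply/eqP.
apply: eq_bigr => i _; congr (_ * _).
by rewrite -(nth_b i (n - i)%N) // subnKC // -ltnS.
Qed.

Lemma at_xM : {morph at_x : A B / A * B}.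
Proof.
move=> A B; apply: fpsP => -[n [|k]] /=; last first.
  rewrite big_seq big1 // => -[[a b] [c d]]; rewrite mem_decomp => /eqP[_ /=].
  by case: b d => [|b] [|d] //= _; rewrite ?mul0r ?mulr0.
transitivity (\sum_(p <- [seq ((q.1, 0%N), (q.2, 0%N)) | q <- decomp n])
   (if p.1.2 == 0%N then A p.1.1 else 0) * (if p.2.2 == 0%N then B p.2.1 else 0)).
  by rewrite big_map.
apply/perm_big/uniq_perm => [||[[a b] [c d]]]; last 1 first.
- rewrite mem_decomp; apply/mapP/eqP => [[[u v]]|].
    by rewrite mem_decomp => /eqP /= <- [-> -> -> ->].
  move=> [/= <- /eqP]; rewrite addn_eq0 => /andP[/eqP -> /eqP ->].
  by exists (a, c); rewrite ?mem_decomp.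
- by rewrite map_inj_uniq ?fset_uniq // => -[u v] [u' v'] [-> ->].
- exact: fset_uniq.
Qed.

Lemma at_yM : {morph at_y : A B / A * B}.
Proof.
move=> A B; apply: fpsP => -[[|k] n] /=; last first.
  rewrite big_seq big1 // => -[[b a] [d c]]; rewrite mem_decomp => /eqP[/= + _].
  by case: b d => [|b] [|d] //= _; rewrite ?mul0r ?mulr0.
transitivity (\sum_(p <- [seq ((0%N, q.1), (0%N, q.2)) | q <- decomp n])
   (if p.1.1 == 0%N then A p.1.2 else 0) * (if p.2.1 == 0%N then B p.2.2 else 0)).
  by rewrite big_map.
apply/perm_big/uniq_perm => [||[[b a] [d c]]]; last 1 first.
- rewrite mem_decomp; apply/mapP/eqP => [[[u v]]|].
    by rewrite mem_decomp => /eqP /= <- [-> -> -> ->].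
  move=> [/= /eqP + <-]; rewrite addn_eq0 => /andP[/eqP -> /eqP ->].
  by exists (a, c); rewrite ?mem_decomp.
- by rewrite map_inj_uniq ?fset_uniq // => -[u v] [u' v'] [-> ->].
- exact: fset_uniq.
Qed.

Lemma at_x1 : at_x 1 = 1.
Proof. by apply: fpsP => -[i j] /=; rewrite xpair_eqE andbC; case: eqP. Qed.

Lemma at_y1 : at_y 1 = 1.
Proof. by apply: fpsP => -[i j] /=; rewrite xpair_eqE; case: eqP. Qed.

Lemma at_x_unit A : A \is a GRing.unit -> at_x A \is a GRing.unit.
Proof.
move=> /mulVr/(congr1 at_x); rewrite at_xM at_x1 => AV.
by apply/asboolP; exists (at_x A^-1).
Qed.

Lemma at_y_unit A : A \is a GRing.unit -> at_y A \is a GRing.unit.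
Proof.
move=> /mulVr/(congr1 at_y); rewrite at_yM at_y1 => AV.
by apply/asboolP; exists (at_y A^-1).
Qed.

End Univariate.

Definition Eser : fps xseries nat := FPS elemsym.

Definition Fser : fps xseries nat := Eser - zvar xseries * fps_deriv Eser.

Lemma Fser_unit : Fser \is a GRing.unit.
Proof.
apply: fps_unit_nat.
rewrite -[LHS]/(elemsym 0 - (zvar xseries * fps_deriv Eser) 0%N) elemsym0.
by rewrite fps_mul_nat big_ord_recl big_ord0 /= mul0r addr0.
Qed.

Lemma Fser_x_unit : at_x Fser \is a GRing.unit.
Proof. exact/at_x_unit/Fser_unit. Qed.

Lemma Fser_y_unit : at_y Fser \is a GRing.unit.
Proof. exact/at_y_unit/Fser_unit. Qed.

Definition CCser : fps xseries (nat * nat)%type :=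
  FPS (fun p => if (0 < p.1)%N && (0 < p.2)%N then chromsym (CC p.1 p.2) else 0).

(* Main.v *)
Require Import Defs.
From HB Require Import structures.
From mathcomp Require Import all_boot all_order all_algebra.
From mathcomp Require Import finmap multiset.
From mathcomp Require Import boolp classical_sets fsbigop.
From mathcomp Require Import ring.

Set Implicit Arguments.
Unset Strict Implicit.
Unset Printing Implicit Defensive.

Import GRing.Theory.
Local Open Scope ring_scope.

(* Setting all but the first N indeterminates t_i to zero is a ring morphism, and
   these morphisms are jointly injective, so finitely many colours suffice; then
   E(z) = \prod_i (1 + t_i z). Fixing the (distinct) colours i, j of v_0 and v_a,
   the two arcs of the cycle are coloured independently, so
     X_(CC_(a,b)) = \sum_(i != j) t_i t_j P_ij(a-1) P_ji(b-1),
   where P_ij(m) sums the weights of the m interior vertices of a proper walk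
   from i to j. Solving the recursion of G_ij(z) = \sum_m P_ij(m) z^m, which is a
   rank one perturbation of a diagonal system, gives for i != j
     G_ij(z) F(z) = E(z) / ((1 + t_i z) (1 + t_j z)).
   With s_i = t_i / ((1 + t_i x) (1 + t_i y)), it remains to expand
   (x - y)^3 ((\sum_i s_i)^2 - \sum_i s_i^2), for which
   (x - y) s_i = t_i x / (1 + t_i x) - t_i y / (1 + t_i y), whereas
   z E' / E = \sum_i u_i and z^2 E'' / E = (\sum_i u_i)^2 - \sum_i u_i^2
   for u_i = t_i z / (1 + t_i z). *)

(** * Partial fractions over a finite family in a commutative ring *)

Section FiniteAlgebra.
Variables (A : comNzRingType) (I : finType) (X Y : A) (t vx vy : I -> A).
Hypotheses (hx : forall i, (1 + t i * X) * vx i = 1).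
Hypotheses (hy : forall i, (1 + t i * Y) * vy i = 1).

Let s i := t i * vx i * vy i.

(** Since [X * (t i * vx i) = 1 - vx i], and likewise for [Y], both sides equal [vy i - vx i]. *)
Lemma sub_mul_summand i : (X - Y) * s i = X * (t i * vx i) - Y * (t i * vy i).
Proof.
have ex : X * (t i * vx i) = 1 - vx i by rewrite -(hx i); ring.
have ey : Y * (t i * vy i) = 1 - vy i by rewrite -(hy i); ring.
have -> : (X - Y) * s i =
  X * (t i * vx i) * vy i - Y * (t i * vy i) * vx i by rewrite /s; ring.
by rewrite ex ey; ring.
Qed.

(** Two factors [X - Y] are absorbed by squaring [sub_mul_summand]. In the cross term the remaining
    one meets [s i] and gives [vy i - vx i], which leaves an expression linear in [t i * vx i] and
    [t i * vy i]. *)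
Lemma sub3_mul_summand_sqr i : (X - Y) ^+ 3 * s i ^+ 2 =
  (X - Y) * (X ^+ 2 * (t i * vx i) ^+ 2 + Y ^+ 2 * (t i * vy i) ^+ 2)
  - 2%:R * X * Y * (t i * vy i - t i * vx i).
Proof.
have ex : X * (t i * vx i) = 1 - vx i by rewrite -(hx i); ring.
have ey : Y * (t i * vy i) = 1 - vy i by rewrite -(hy i); ring.
have xy : (X - Y) * s i = vy i - vx i by rewrite sub_mul_summand ex ey; ring.
have -> : (X - Y) ^+ 3 * s i ^+ 2 = (X - Y) * ((X - Y) * s i) ^+ 2 by ring.
rewrite sub_mul_summand.
have -> : t i * vy i - t i * vx i = t i * (vy i - vx i) by ring.
by rewrite -xy /s; ring.
Qed.

Lemma sum_neq_mul (f : I -> A) :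
  \sum_i \sum_(j | i != j) f i * f j = (\sum_i f i) ^+ 2 - \sum_i f i ^+ 2.
Proof.
apply/eqP; rewrite eq_sym subr_eq -big_split expr2 mulr_suml /=; apply/eqP.
apply: eq_bigr => i _; rewrite mulr_sumr (bigD1 i) //= addrC -expr2.
by congr (_ + _); apply: eq_bigl => j; rewrite eq_sym.
Qed.

(** When [Ex] is E(x), the products [Ex * p], [Ex * (p ^+ 2 - p2)] and [Ex - X * (Ex * p)] become
    E'(x), E''(x) and F(x); similarly for y. The cross term in [p * q] from the square of the sum of
    the [s i] is what completes the two factors F on the right. *)
Lemma chord_sum (Ex Ey : A) (p := \sum_i t i * vx i) (q := \sum_i t i * vy i)
    (p2 := \sum_i (t i * vx i) ^+ 2) (q2 := \sum_i (t i * vy i) ^+ 2) :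
  (X - Y) ^+ 3 * (\sum_i \sum_(j | i != j)
    t i * t j * ((Ex * vx i * vx j) * (Ey * vy j * vy i))) =
  (X - Y) * (X ^+ 2 * (Ex * (p ^+ 2 - p2)) * Ey + Y ^+ 2 * (Ey * (q ^+ 2 - q2)) * Ex)
  - 2%:R * X * Y * (Ex * p * (Ey - Y * (Ey * q)) - Ey * q * (Ex - X * (Ex * p))).
Proof.
have -> : \sum_i \sum_(j | i != j)
    t i * t j * ((Ex * vx i * vx j) * (Ey * vy j * vy i)) =
    Ex * Ey * ((\sum_i s i) ^+ 2 - \sum_i s i ^+ 2).
  rewrite -sum_neq_mul mulr_sumr; apply: eq_bigr => i _.
  by rewrite mulr_sumr; apply: eq_bigr => j _; rewrite /s; ring.
have S1 : (X - Y) * \sum_i s i = X * p - Y * q.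
  rewrite mulr_sumr /p /q !mulr_sumr -sumrB; apply: eq_bigr => i _; exact: sub_mul_summand.
have S2 : (X - Y) ^+ 3 * \sum_i s i ^+ 2 =
    (X - Y) * (X ^+ 2 * p2 + Y ^+ 2 * q2) - 2%:R * X * Y * (q - p).
  rewrite mulr_sumr; under eq_bigr do rewrite sub3_mul_summand_sqr.
  by rewrite sumrB -!mulr_sumr big_split sumrB /= -!mulr_sumr.
have -> : (X - Y) ^+ 3 * (Ex * Ey * ((\sum_i s i) ^+ 2 - \sum_i s i ^+ 2)) =
  Ex * Ey * ((X - Y) * ((X - Y) * \sum_i s i) ^+ 2 - (X - Y) ^+ 3 * \sum_i s i ^+ 2).
  by ring.
by rewrite S1 S2; ring.
Qed.

End FiniteAlgebra.

(** * Constant series and coefficientwise ring morphisms *)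

Section FpsCoef.
Variables (R : comNzRingType) (M : expoType).

Lemma fps_mulE (f g : fps R M) m :
  (f * g) m = \sum_(p <- decomp m) f p.1 * g p.2.
Proof. by []. Qed.

Lemma fps_sumE (I : Type) (r : seq I) (P : pred I) (F : I -> fps R M) m :
  (\sum_(i <- r | P i) F i) m = \sum_(i <- r | P i) F i m.
Proof. exact: (big_morph (fun f : fps R M => f m) (fun _ _ => erefl) erefl). Qed.

Definition fps_const (c : R) : fps R M := FPS (fun m => if m == 0 then c else 0).

Lemma fps_constE c (f : fps R M) m : (fps_const c * f) m = c * f m.
Proof.
rewrite fps_mulE (bigD1_seq (0, m)) ?fset_uniq ?mem_decomp /= ?add0r ?eqxx //=.
rewrite big_seq_cond big1 ?addr0 // => -[u v] /=.
rewrite mem_decomp /= => /andP[/eqP <-]; have [->|_ _] := eqVneq u 0.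
  by rewrite add0r eqxx.
by rewrite mul0r.
Qed.

End FpsCoef.

Section FpsConst.
Variables (R : comNzRingType) (M : expoType).

Fact fps_const_zmod_morphism : zmod_morphism (@fps_const R M).
Proof.
by move=> c d; apply: fpsP => m; rewrite /= -[RHS]/(_ - _) /=; case: ifP; rewrite ?subr0.
Qed.
HB.instance Definition _ := GRing.isZmodMorphism.Build _ _ _ fps_const_zmod_morphism.

Fact fps_const_monoid_morphism : monoid_morphism (@fps_const R M).
Proof.
split=> [|c d]; apply: fpsP => m; first by rewrite /=; case: eqP.
by rewrite fps_constE /=; case: eqP; rewrite ?mulr0.
Qed.
HB.instance Definition _ := GRing.isMonoidMorphism.Build _ _ _ fps_const_monoid_morphism.

End FpsConst.

Section FpsMap.
Variables (R S : comNzRingType) (f : {rmorphism R -> S}).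

Definition fps_map (M : expoType) (A : fps R M) : fps S M := FPS (fun m => f (A m)).

Fact fps_map_zmod_morphism (M : expoType) : zmod_morphism (@fps_map M).
Proof. by move=> A B; apply: fpsP => m; apply: rmorphB. Qed.
HB.instance Definition _ (M : expoType) :=
  GRing.isZmodMorphism.Build _ _ _ (@fps_map_zmod_morphism M).

Lemma fps_map_monom (M : expoType) (m : M) : fps_map (fps_monom R m) = fps_monom S m.
Proof. by apply: fpsP => n; rewrite /= rmorph_nat. Qed.

Fact fps_map_monoid_morphism (M : expoType) : monoid_morphism (@fps_map M).
Proof.
split=> [|A B]; first exact: fps_map_monom.
apply: fpsP => m; rewrite fps_mulE /= rmorph_sum.
by apply: eq_bigr => p _; rewrite rmorphM.
Qed.
HB.instance Definition _ (M : expoType) :=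
  GRing.isMonoidMorphism.Build _ _ _ (@fps_map_monoid_morphism M).

Lemma fps_map_at_x (A : fps R nat) : fps_map (at_x A) = at_x (fps_map A).
Proof. by apply: fpsP => p /=; case: ifP => //; rewrite rmorph0. Qed.

Lemma fps_map_at_y (A : fps R nat) : fps_map (at_y A) = at_y (fps_map A).
Proof. by apply: fpsP => p /=; case: ifP => //; rewrite rmorph0. Qed.

Lemma fps_map_deriv (A : fps R nat) : fps_map (fps_deriv A) = fps_deriv (fps_map A).
Proof. by apply: fpsP => n /=; rewrite rmorphMn. Qed.

End FpsMap.

(** * Substitution, shifts and differentiation of univariate series *)

Section Univariate.
Variable R : comNzRingType.
Implicit Types A B : fps R nat.

Fact at_x_zmod_morphism : zmod_morphism (@at_x R).
Proof.
by move=> A B; apply: fpsP => p; rewrite /= -[RHS]/(_ - _) /=; case: ifP; rewrite ?subr0.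
Qed.
HB.instance Definition _ := GRing.isZmodMorphism.Build _ _ _ at_x_zmod_morphism.
HB.instance Definition _ := GRing.isMonoidMorphism.Build _ _ (@at_x R) (conj (@at_x1 R) (@at_xM R)).

Fact at_y_zmod_morphism : zmod_morphism (@at_y R).
Proof.
by move=> A B; apply: fpsP => p; rewrite /= -[RHS]/(_ - _) /=; case: ifP; rewrite ?subr0.
Qed.
HB.instance Definition _ := GRing.isZmodMorphism.Build _ _ _ at_y_zmod_morphism.
HB.instance Definition _ := GRing.isMonoidMorphism.Build _ _ (@at_y R) (conj (@at_y1 R) (@at_yM R)).

Lemma at_x_zvar : at_x (zvar R) = xind R.
Proof. by apply: fpsP => -[[|[|i]] [|j]]. Qed.
Lemma at_y_zvar : at_y (zvar R) = yind R.
Proof. by apply: fpsP => -[[|i] [|[|j]]]. Qed.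

Lemma at_x_const (c : R) : at_x (fps_const nat c) = fps_const _ c.
Proof. by apply: fpsP => -[[|i] [|j]]. Qed.
Lemma at_y_const (c : R) : at_y (fps_const nat c) = fps_const _ c.
Proof. by apply: fpsP => -[[|i] [|j]]. Qed.

Lemma at_xy_coef A B i j : (at_x A * at_y B) (i, j) = A i * B j.
Proof.
rewrite fps_mulE (bigD1_seq ((i, 0), (0, j))%N) ?fset_uniq ?mem_decomp //=; last first.
  by apply/eqP; congr (_, _); apply: addn0.
rewrite big_seq_cond big1 ?addr0 // => -[[u v] [u' v']].
rewrite mem_decomp => /andP[/eqP[/= <- <-]].
case: v => [|v]; last by rewrite mul0r.
case: u' => [|u']; last by rewrite mulr0.
by rewrite addr0 add0r eqxx.
Qed.

Lemma zvar_mul0 A : (zvar R * A) 0%N = 0.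
Proof. by rewrite fps_mul_nat big_ord_recl big_ord0 /= mul0r addr0. Qed.

Lemma zvar_mulS A n : (zvar R * A) n.+1 = A n.
Proof.
rewrite fps_mul_nat !big_ord_recl /= mul0r add0r mul1r subn1.
by rewrite big1 ?addr0 // => i _; rewrite mul0r.
Qed.

Lemma xy_mul_coef (A : fps R (nat * nat)%type) p : (xind R * yind R * A) p =
  if (0 < p.1)%N && (0 < p.2)%N then A (p.1.-1, p.2.-1) else 0.
Proof.
rewrite -fps_monomD; case: p => -[|i] [|j] //=.
(* If one exponent of [p] is zero, the monomial xy does not divide it. *)
1-3: by rewrite big_seq big1 // => -[[[|[|u]] [|[|v]]] [u' v']];
   rewrite mem_decomp /= => /eqP[] //= *; rewrite mul0r.
rewrite (bigD1_seq ((1, 1), (i, j))%N) ?fset_uniq ?mem_decomp //= mul1r.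
rewrite big_seq_cond big1 ?addr0 // => -[u v] /=.
rewrite mem_decomp /= => /andP[/eqP].
have [->|_ _ _] := eqVneq u (1, 1)%N; last by rewrite mul0r.
by case: v => i' j' [<- <-]; rewrite eqxx.
Qed.

Lemma fps_derivM A B : fps_deriv (A * B) = fps_deriv A * B + A * fps_deriv B.
Proof.
apply: fpsP => n; rewrite -[RHS]/((fps_deriv A * B) n + (A * fps_deriv B) n).
rewrite -[LHS]/((A * B) n.+1 *+ n.+1) !fps_mul_nat -sumrMnl.
(* The factor n + 1 is split as i + (n + 1 - i): the first part differentiates [A], the second
   differentiates [B]. *)
have -> : \sum_(i < n.+2) A i * B (n.+1 - i)%N *+ n.+1 =
   \sum_(i < n.+2) A i * B (n.+1 - i)%N *+ i +
   \sum_(i < n.+2) A i * B (n.+1 - i)%N *+ (n.+1 - i).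
  rewrite -big_split; apply: eq_bigr => i _ /=.
  by rewrite -mulrnDr subnKC // -ltnS.
congr (_ + _).
  rewrite big_ord_recl mulr0n add0r; apply: eq_bigr => i _.
  by rewrite /= subSS mulrnAl.
rewrite big_ord_recr /= subnn mulr0n addr0; apply: eq_bigr => i _.
have le_in : (i <= n)%N by rewrite -ltnS.
by rewrite subSn //= mulrnAr.
Qed.

Fact fps_deriv_zmod_morphism : zmod_morphism (@fps_deriv R).
Proof. by move=> A B; apply: fpsP => n; apply: mulrnBl. Qed.
HB.instance Definition _ := GRing.isZmodMorphism.Build _ _ _ fps_deriv_zmod_morphism.

Lemma fps_deriv_const (c : R) : fps_deriv (fps_const nat c) = 0.
Proof. by apply: fpsP => n; apply: mul0rn. Qed.

Lemma fps_deriv1 : fps_deriv (1 : fps R nat) = 0.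
Proof. by apply: fpsP => n; apply: mul0rn. Qed.

Lemma fps_deriv_zvar : fps_deriv (zvar R) = 1.
Proof. by apply: fpsP => -[|n] //=; rewrite mul0rn. Qed.

Lemma fps_deriv_lin (c : R) : fps_deriv (1 + fps_const nat c * zvar R) = fps_const nat c.
Proof.
rewrite raddfD /= fps_derivM fps_deriv_const fps_deriv_zvar mulr1 mul0r add0r.
by rewrite fps_deriv1 add0r.
Qed.

Lemma fps_lin_unit (c : R) : 1 + fps_const nat c * zvar R \is a GRing.unit.
Proof.
apply: fps_unit_nat; rewrite -[LHS]/(1 + (fps_const nat c * zvar R) 0%N).
by rewrite mulrC zvar_mul0 addr0.
Qed.

End Univariate.

(** * Logarithmic derivatives of a product of linear factors *)

Section ProdLin.
Variables (R : comNzRingType) (I : finType) (t : I -> R).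
Notation z := (zvar R).
Let tc i : fps R nat := fps_const nat (t i).
Definition lin_inv i : fps R nat := (1 + tc i * z)^-1.
Notation v := lin_inv.

Definition prod_lin : fps R nat := \prod_i (1 + tc i * z).

Lemma mul_lin_inv i : (1 + tc i * z) * v i = 1.
Proof. exact/divrr/fps_lin_unit. Qed.

Lemma fps_deriv_prod_lin :
  fps_deriv prod_lin = prod_lin * \sum_i tc i * v i.
Proof.
rewrite /prod_lin.
elim/big_rec2: _ => [|i S A _ IH]; first by rewrite mulr0 fps_deriv1.
rewrite fps_derivM IH fps_deriv_lin mulrDr mulrA; congr (_ + _).
by rewrite -[LHS]mul1r -{1}(mul_lin_inv i) /tc; ring.
Qed.

(** Obtained by differentiating [mul_lin_inv] and solving for the derivative of [v i]. *)
Lemma fps_deriv_lin_inv i : fps_deriv (tc i * v i) = - (tc i * v i) ^+ 2.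
Proof.
have := congr1 (@fps_deriv R) (mul_lin_inv i).
rewrite fps_derivM fps_deriv_lin -/(tc i) fps_deriv1 => /eqP.
rewrite addrC addr_eq0 => /eqP Dv.
rewrite fps_derivM fps_deriv_const mul0r add0r.
rewrite -[fps_deriv (v i)]mul1r -{1}(mul_lin_inv i) mulrAC Dv.
by ring.
Qed.

Lemma fps_deriv2_prod_lin : fps_deriv (fps_deriv prod_lin) =
  prod_lin * ((\sum_i tc i * v i) ^+ 2 - \sum_i (tc i * v i) ^+ 2).
Proof.
rewrite fps_deriv_prod_lin fps_derivM fps_deriv_prod_lin raddf_sum /=.
by rewrite (eq_bigr _ (fun i _ => fps_deriv_lin_inv i)) sumrN; ring.
Qed.

End ProdLin.

Definition properb (G : sgraph) (C : eqType) (k : {ffun G -> C}) :=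
  [forall u, forall v, adj u v ==> (k u != k v)].

Definition neq (C : eqType) : rel C := fun i j => i != j.

(** * Weighted proper walks with prescribed ends *)

Section Walks.
Variables (R : comNzRingType) (C : finType) (t : C -> R).

(** This is P_ij(m). The weights of the ends are left out because the two arcs of the cycle share
    them. *)
Definition walk_sum (i j : C) (m : nat) : R :=
  \sum_(s : m.-tuple C | path (@neq C) i (rcons s j)) \prod_(c <- s) t c.

Lemma walk_sum0 i j : walk_sum i j 0 = (i != j)%:R.
Proof.
rewrite /walk_sum big_mkcond (big_pred1 [tuple]) => [|s]; last first.
  by rewrite (tuple0 s) /= eqxx.
by rewrite big_nil /= andbT /neq; case: eqP.
Qed.

Lemma walk_sumS i j m :
  walk_sum i j m.+1 = \sum_(k | i != k) t k * walk_sum k j m.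
Proof.
rewrite /walk_sum; under [RHS]eq_bigr do rewrite mulr_sumr.
rewrite pair_big_dep /= (reindex (fun p : C * m.-tuple C => cons_tuple p.1 p.2)).
  by apply: eq_big => [[k s]|[k s] _] //=; rewrite big_cons.
exists (fun s : m.+1.-tuple C => (thead s, behead_tuple s)) => [[k s] _|s _] /=.
  by congr (_, _); apply: val_inj.
by rewrite [RHS]tuple_eta; apply: val_inj.
Qed.

End Walks.

(** * Proper colourings of the cycle-chord graph as pairs of walks *)

Section Chord.
Variables (C : finType) (a b : nat).

(** The colours read around the cycle: the ends of the chord sit at positions 0 and a + 1, so the
    graph coloured is [CC a.+1 b.+1]. *)
Definition chord_word (q : (C * a.-tuple C) * (C * b.-tuple C)) : seq C :=
  (q.1.1 :: q.1.2) ++ (q.2.1 :: q.2.2).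

Lemma size_chord_word q : size (chord_word q) = (a.+1 + b.+1)%N.
Proof. by rewrite size_cat /= !size_tuple. Qed.

Definition chord_coloring q : {ffun 'I_(a.+1 + b.+1) -> C} :=
  [ffun v => nth q.1.1 (chord_word q) (val v)].

(** The colouring determines the word, which splits at a fixed position; this gives injectivity, and
    the two finite types have equal cardinality. *)
Lemma chord_coloring_bij : bijective chord_coloring.
Proof.
apply: inj_card_bij => [q q' /ffunP eq_q|]; last first.
  by rewrite !card_prod !card_tuple card_ffun card_ord -!expnS -expnD.
have: chord_word q = chord_word q'.
  apply: (@eq_from_nth _ q.1.1) => [|i]; first by rewrite !size_chord_word.
  rewrite size_chord_word => lt_i; move: (eq_q (Ordinal lt_i)).
  rewrite !ffunE /= => ->; apply: set_nth_default.
  by rewrite size_chord_word.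
case: q q' {eq_q} => [[i s] [j s']] [[i' s1] [j' s1']] /eqP.
rewrite eqseq_cat /= ?size_tuple // => /andP[/eqP[-> eq_s] /eqP[-> eq_s']].
by congr (_, _, (_, _)); apply: val_inj.
Qed.

Lemma properb_chord_coloring q :
  @properb (CC a.+1 b.+1) C (chord_coloring q) =
  [&& q.1.1 != q.2.1, path (@neq C) q.1.1 (rcons q.1.2 q.2.1)
    & path (@neq C) q.2.1 (rcons q.2.2 q.1.1)].
Proof.
set x0 := q.1.1; set w := chord_word q.
have sz_w := size_chord_word q; rewrite -/w in sz_w.
have w0 : nth x0 w 0 = q.1.1 by [].
have wa : nth x0 w a.+1 = q.2.1.
  by rewrite /w /chord_word nth_cat /= size_tuple ltnn subnn.
(* The two arcs are glued at their common end into one closed walk around the whole cycle. *)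
have -> : path (@neq C) x0 (rcons q.1.2 q.2.1) && path (@neq C) q.2.1 (rcons q.2.2 x0) =
    path (@neq C) x0 (rcons (behead w) x0).
  by rewrite /w /chord_word /= rcons_cat /= -cat_rcons cat_path last_rcons.
have ffE v : chord_coloring q v = nth x0 w v by rewrite ffunE.
have w_cons : x0 :: rcons (behead w) x0 = rcons w x0 by [].
clearbody w.
(* In the closed walk the entry after position v is the colour of the cyclic successor of v; the
   appended [x0] accounts for the wrap to 0. *)
have nthw v : (v < a.+1 + b.+1)%N ->
    nth x0 (rcons (behead w) x0) v = nth x0 w (v.+1 %% (a.+1 + b.+1)).
  move=> lt_v; rewrite nth_rcons size_behead sz_w /=.
  move: lt_v; rewrite addSn ltnS leq_eqVlt => /predU1P[->|lt_v].
    by rewrite ltnn eqxx modnn w0.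
  by rewrite lt_v nth_behead modn_small // ltnS.
have nthw' v : (v < a.+1 + b.+1)%N -> nth x0 (x0 :: rcons (behead w) x0) v = nth x0 w v.
  move=> lt_v.
  by rewrite w_cons nth_rcons sz_w lt_v.
apply/forallP/andP => [col|[ne_ij /(pathP x0) pw] u].
  have colP (u v : CC a.+1 b.+1) : adj u v -> chord_coloring q u != chord_coloring q v.
    by move: (col u) => /forallP/(_ v)/implyP.
  split; [|apply/(pathP x0) => v; rewrite size_rcons size_behead sz_w => lt_v].
    have lt_a : (a.+1 < a.+1 + b.+1)%N by rewrite addnS ltnS leq_addr.
    have /colP : @adj (CC a.+1 b.+1) ord0 (Ordinal lt_a) by rewrite /= /cc_adj /= eqxx !orbT.
    by rewrite !ffE /= w0 wa.
  have lt_v1 : (v.+1 %% (a.+1 + b.+1) < a.+1 + b.+1)%N by rewrite ltn_mod.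
  have /colP : @adj (CC a.+1 b.+1) (Ordinal lt_v) (Ordinal lt_v1).
    rewrite /= /cc_adj /= eqxx /= andbT -val_eqE /=.
    (* It remains that a vertex differs from its successor, which holds as the cycle has at least
       two vertices. *)
    move: lt_v; rewrite leq_eqVlt => /predU1P[[->]|lt_v].
      by rewrite modnn addnS.
    by rewrite modn_small // neq_ltn ltnSn.
  by rewrite !ffE /= /neq nthw' ?nthw.
apply/forallP => v; apply/implyP; rewrite /= /cc_adj !ffE.
have step (i j : 'I_(a.+1 + b.+1)) :
    val j = (i.+1 %% (a.+1 + b.+1))%N -> nth x0 w i != nth x0 w j.
  move=> ->; have := pw i; rewrite size_rcons size_behead sz_w /=.
  by move/(_ (ltn_ord i)); rewrite /neq nthw' ?nthw.
move=> /andP[_ /or3P[/eqP/step //|/eqP/step|]]; first by rewrite eq_sym.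
case/orP => /andP[/eqP/= -> /eqP/= ->]; rewrite w0 wa //.
by rewrite eq_sym.
Qed.

End Chord.

Lemma sum_properb_CC (R : comNzRingType) (C : finType) (t : C -> R) a b :
  \sum_(k : {ffun CC a.+1 b.+1 -> C} | properb k) \prod_v t (k v) =
  \sum_i \sum_(j | i != j)
    t i * t j * (walk_sum t i j a * walk_sum t j i b).
Proof.
rewrite (reindex (@chord_coloring C a b)) /=; last exact/onW_bij/chord_coloring_bij.
under eq_bigl do rewrite properb_chord_coloring.
have prodE q : \prod_(v : 'I_(a.+1 + b.+1)) t (chord_coloring q v) =
    t q.1.1 * (\prod_(c <- q.1.2) t c) * (t q.2.1 * \prod_(c <- q.2.2) t c).
  transitivity (\prod_(c <- chord_word q) t c); last by rewrite big_cat !big_cons.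
  rewrite (big_nth q.1.1) size_chord_word big_mkord.
  by apply: eq_bigr => v _; rewrite ffunE.
under eq_bigr do rewrite prodE.
rewrite -(pair_big_dep xpredT (fun (p : C * a.-tuple C) (q : C * b.-tuple C) =>
   [&& p.1 != q.1, path (@neq C) p.1 (rcons p.2 q.1)
    & path (@neq C) q.1 (rcons q.2 p.1)]) (fun p q =>
   t p.1 * (\prod_(c <- p.2) t c) * (t q.1 * \prod_(c <- q.2) t c))) /=.
rewrite -(pair_big xpredT xpredT (fun i (s : a.-tuple C) =>
  \sum_(q : C * b.-tuple C | [&& i != q.1, path (@neq C) i (rcons s q.1)
    & path (@neq C) q.1 (rcons q.2 i)])
   t i * (\prod_(c <- s) t c) * (t q.1 * \prod_(c <- q.2) t c))) /=.
apply: eq_bigr => i _.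
(* For a fixed first arc [s], the end [j] is separated from the second arc. Moving the sum over [j]
   outside then makes the sums over the two arcs factor. *)
under eq_bigr => s _.
  rewrite (eq_bigl _ _ (fun q => andbA _ _ _)).
  rewrite -(pair_big_dep (fun j => (i != j) && path (@neq C) i (rcons s j))
    (fun j (s' : b.-tuple C) => path (@neq C) j (rcons s' i))
   (fun j s' => t i * (\prod_(c <- s) t c) * (t j * \prod_(c <- s') t c))) /=.
  over.
rewrite (exchange_big_dep (fun j => i != j)) //=; last by move=> s j _ /andP[].
apply: eq_bigr => j ij; rewrite /walk_sum mulr_suml mulr_sumr.
apply: eq_big => [s|s _]; first by rewrite ij.
rewrite !mulr_sumr; apply: eq_bigr => s' _.
exact: mulrACA.
Qed.

(** * Generating series of walks and of chord colourings *)

Section WalkSeries.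
Variables (R : comNzRingType) (I : finType) (t : I -> R).
Notation z := (zvar R).
Let tc i : fps R nat := fps_const nat (t i).
Notation v := (lin_inv t).
Notation E := (prod_lin t).
Let F := E - z * fps_deriv E.

Definition walk_series i j : fps R nat := FPS (walk_sum t i j).
Notation G := walk_series.

Lemma walk_series_rec i j :
  G i j = (i != j)%:R + z * \sum_(k | i != k) tc k * G k j.
Proof.
rewrite -(rmorph_nat (@fps_const R nat)); apply: fpsP => n.
rewrite -[RHS]/(fps_const nat (i != j)%:R n + (z * \sum_(k | i != k) tc k * G k j) n).
case: n => [|n]; first by rewrite zvar_mul0 addr0; apply: walk_sum0.
rewrite zvar_mulS fps_sumE add0r -[LHS]/(walk_sum t i j n.+1) walk_sumS.
by apply: eq_bigr => k _; rewrite fps_constE.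
Qed.

(** For fixed [j], adding the missing term k = i to the recursion replaces the restricted sum by the
    full sum [S], which does not depend on [i]. Everything then reduces to the single unknown
    [S]. *)
Lemma walk_seriesMF i j : i != j -> G i j * F = E * v i * v j.
Proof.
move=> ne_ij; pose S := \sum_k tc k * G k j; pose p := \sum_k tc k * v k.
have GS k : G k j = v k * ((k != j)%:R + z * S).
  have : (1 + tc k * z) * G k j = (k != j)%:R + z * S.
    rewrite /S (bigD1 k) //= mulrDl mul1r {1}walk_series_rec.
    by rewrite (eq_bigl (fun l => l != k)) => [|l]; [ring | rewrite eq_sym].
  by move=> <-; rewrite mulrA [v k * _]mulrC mul_lin_inv mul1r.
have pE : p - tc j * v j = \sum_k tc k * v k * (k != j)%:R.
  have -> : p = tc j * v j + \sum_(k | k != j) tc k * v k by rewrite /p (bigD1 j).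
  rewrite addrC addKr [RHS](bigD1 j) //= eqxx mulr0 add0r.
  by apply: eq_bigr => k ->; rewrite mulr1.
(* Substituting [GS] into the definition of [S] gives a scalar linear equation. Its coefficient
   [1 - z * p] is F / E, so multiplying by F makes solving it unnecessary. *)
have SE : S * (1 - z * p) = p - tc j * v j.
  have : S = (p - tc j * v j) + z * S * p.
    rewrite pE [X in _ + X]mulr_sumr -big_split {1}/S; apply: eq_bigr => k _ /=.
    by rewrite GS mulrA mulrDr; congr (_ + _); apply: mulrC.
  move=> eS; have -> : S * (1 - z * p) = S - z * S * p by ring.
  by rewrite {1}eS addrK.
have Fp : F = E * (1 - z * p) by rewrite /F fps_deriv_prod_lin -/p; ring.
have vj : v j = 1 - z * (tc j * v j) by rewrite -{1}(mul_lin_inv t j) -/(tc j); ring.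
rewrite GS ne_ij Fp -[true%:R]/1.
have -> : v i * (1 + z * S) * (E * (1 - z * p)) =
   E * v i * (1 - z * p + z * (S * (1 - z * p))) by ring.
by rewrite SE [in RHS]vj; congr (_ * _); ring.
Qed.

(** This is the image of [CCser] when only the colours in [I] remain. The predecessors appear
    because an arc with a edges has a - 1 interior vertices. *)
Definition chord_series : fps R (nat * nat)%type :=
  FPS (fun p => if (0 < p.1)%N && (0 < p.2)%N then
    \sum_i \sum_(j | i != j)
      t i * t j * (walk_sum t i j p.1.-1 * walk_sum t j i p.2.-1) else 0).

Lemma chord_seriesE : chord_series = xind R * yind R * \sum_i \sum_(j | i != j)
  fps_const _ (t i) * fps_const _ (t j) * (at_x (G i j) * at_y (G j i)).
Proof.
apply: fpsP => p; rewrite xy_mul_coef /=; case: ifP => // _.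
rewrite fps_sumE; apply: eq_bigr => i _; rewrite fps_sumE; apply: eq_bigr => j _.
by rewrite -!(mulrA _ _ (_ * _)) !fps_constE at_xy_coef.
Qed.

Lemma chord_seriesMF (x := xind R) (y := yind R)
  (E' := fps_deriv E) (E'' := fps_deriv E') :
  (x - y) ^+ 3 * chord_series * (at_x F * at_y F) =
  x * y * ((x - y) * (x ^+ 2 * at_x E'' * at_y E + y ^+ 2 * at_y E'' * at_x E)
           - 2%:R * x * y * (at_x E' * at_y F - at_y E' * at_x F)).
Proof.
pose c i : fps R (nat * nat)%type := fps_const _ (t i).
have hx i : (1 + c i * x) * at_x (v i) = 1.
  rewrite -[RHS](@at_x1 R) -(mul_lin_inv t i) rmorphM rmorphD rmorphM.
  by rewrite rmorph1 /= at_x_const at_x_zvar.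
have hy i : (1 + c i * y) * at_y (v i) = 1.
  rewrite -[RHS](@at_y1 R) -(mul_lin_inv t i) rmorphM rmorphD rmorphM.
  by rewrite rmorph1 /= at_y_const at_y_zvar.
(* The factors F(x) and F(y) are spent on the two walk series of each summand, bringing it to the
   shape treated by [chord_sum]. *)
have chordF : chord_series * (at_x F * at_y F) = x * y * \sum_i \sum_(j | i != j)
    c i * c j * ((at_x E * at_x (v i) * at_x (v j)) * (at_y E * at_y (v j) * at_y (v i))).
  rewrite chord_seriesE -mulrA mulr_suml; congr (_ * _); apply: eq_bigr => i _.
  rewrite mulr_suml; apply: eq_bigr => j ij.
  rewrite -!(rmorphM (@at_x R)) -!(rmorphM (@at_y R)) -walk_seriesMF //.
  by rewrite -walk_seriesMF 1?eq_sym // !rmorphM -!mulrA /=; congr (_ * (_ * _)); ring.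
have xp : at_x (\sum_i tc i * v i) = \sum_i c i * at_x (v i).
  by rewrite rmorph_sum; apply: eq_bigr => i _; rewrite rmorphM /= at_x_const.
have yp : at_y (\sum_i tc i * v i) = \sum_i c i * at_y (v i).
  by rewrite rmorph_sum; apply: eq_bigr => i _; rewrite rmorphM /= at_y_const.
have xp2 : at_x (\sum_i (tc i * v i) ^+ 2) = \sum_i (c i * at_x (v i)) ^+ 2.
  by rewrite rmorph_sum; apply: eq_bigr => i _; rewrite rmorphXn rmorphM /= at_x_const.
have yp2 : at_y (\sum_i (tc i * v i) ^+ 2) = \sum_i (c i * at_y (v i)) ^+ 2.
  by rewrite rmorph_sum; apply: eq_bigr => i _; rewrite rmorphXn rmorphM /= at_y_const.
have Ex' : at_x E' = at_x E * \sum_i c i * at_x (v i).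
  by rewrite /E' fps_deriv_prod_lin rmorphM /= xp.
have Ey' : at_y E' = at_y E * \sum_i c i * at_y (v i).
  by rewrite /E' fps_deriv_prod_lin rmorphM /= yp.
have Ex'' : at_x E'' = at_x E * ((\sum_i c i * at_x (v i)) ^+ 2 - \sum_i (c i * at_x (v i)) ^+ 2).
  by rewrite /E'' /E' fps_deriv2_prod_lin rmorphM rmorphB rmorphXn /= xp xp2.
have Ey'' : at_y E'' = at_y E * ((\sum_i c i * at_y (v i)) ^+ 2 - \sum_i (c i * at_y (v i)) ^+ 2).
  by rewrite /E'' /E' fps_deriv2_prod_lin rmorphM rmorphB rmorphXn /= yp yp2.
have Fx : at_x F = at_x E - x * at_x E' by rewrite /F rmorphB rmorphM /= at_x_zvar.
have Fy : at_y F = at_y E - y * at_y E' by rewrite /F rmorphB rmorphM /= at_y_zvar.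
rewrite -mulrA chordF mulrCA (chord_sum hx hy) Fx Fy Ex' Ey' Ex'' Ey''.
by congr (_ * _); ring.
Qed.

End WalkSeries.

(** * Truncation to finitely many indeterminates *)

Section Truncation.
Variable N : nat.

Definition low (m : xmonom) := all (fun i => i < N)%N (m : xmonom).

Lemma lowD (m n : xmonom) : low (m + n) = low m && low n.
Proof.
apply/allP/andP => [low_mn|[/allP low_m /allP low_n] i].
  by split; apply/allP => i im; apply: low_mn; rewrite in_msetD im ?orbT.
by rewrite in_msetD => /orP[/low_m|/low_n].
Qed.

Lemma low0 : low 0.
Proof. by apply/allP => i; rewrite in_mset0. Qed.

Definition trunc (f : xseries) : xseries := FPS (fun m => if low m then f m else 0).

Fact trunc_zmod_morphism : zmod_morphism trunc.
Proof.
by move=> f g; apply: fpsP => m; rewrite /= -[RHS]/(_ - _) /=; case: ifP; rewrite ?subr0.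
Qed.
HB.instance Definition _ := GRing.isZmodMorphism.Build _ _ _ trunc_zmod_morphism.

(** By [lowD] a product of monomials is low exactly when both factors are, so discarding the other
    monomials respects the Cauchy product. *)
Fact trunc_monoid_morphism : monoid_morphism trunc.
Proof.
split=> [|f g]; apply: fpsP => m /=.
  by case: ifPn => // ; have [->|//] := eqVneq m 0; rewrite low0.
rewrite [RHS]big_seq; have [low_m|nlow_m] := ifPn.
  rewrite big_seq; apply: eq_bigr => p; rewrite mem_decomp => /eqP def_m.
  by move: low_m; rewrite -def_m lowD => /andP[-> ->].
rewrite big1 // => p; rewrite mem_decomp => /eqP def_m.
by move: nlow_m; rewrite -def_m lowD negb_and => /orP[] /negPf ->; rewrite ?mul0r ?mulr0.
Qed.
HB.instance Definition _ := GRing.isMonoidMorphism.Build _ _ _ trunc_monoid_morphism.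

Lemma trunc_xvar i : (i < N)%N -> trunc (xvar i) = xvar i.
Proof.
move=> lt_i; apply: fpsP => m /=; case: ifPn => //.
have [->|//] := eqVneq; case/negP; apply/allP => j.
by rewrite in_mset1 => /eqP ->.
Qed.

(** Here [h] enumerates the members of the family that survive truncation. All others contribute to
    no low monomial, so the formal sum becomes an ordinary finite one. *)
Lemma trunc_fps_sum (T : choiceType) (D : set T) (F : T -> xseries)
    (J : finType) (P : pred J) (h : J -> T) :
  {in P &, injective h} ->
  (forall j, P j -> D (h j) /\ trunc (F (h j)) = F (h j)) ->
  (forall i m, D i -> low m -> F i m != 0 -> exists2 j, P j & h j = i) ->
  trunc (fps_sum D F) = \sum_(j | P j) F (h j).
Proof.
move=> h_inj hD h_surj; apply: fpsP => m; rewrite fps_sumE /=.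
case: ifPn => [low_m|/negPf nlow_m]; last first.
  rewrite big1 // => j /hD[_ <-] /=; by rewrite nlow_m.
rewrite (fsbigE [seq h j | j <- enum P]) /=.
- rewrite big_map big_enum_cond /= ; apply: eq_bigl => j.
  by apply: andb_idr => /hD[Dj _]; apply/mem_set.
- rewrite map_inj_in_uniq ?enum_uniq // => j k.
  by rewrite !mem_enum; apply: h_inj.
- by move=> i /mapP[j]; rewrite mem_enum => /hD[Dj _] ->.
move=> i Di; apply: contraNeq => /(h_surj i m Di low_m)[j Pj <-].
by apply: map_f; rewrite mem_enum.
Qed.

Lemma trunc_chromsym (G : sgraph) :
  trunc (chromsym G) =
  \sum_(k : {ffun G -> 'I_N} | properb k) \prod_v xvar (k v).
Proof.
pose h (k : {ffun G -> 'I_N}) : {ffun G -> nat} := [ffun v => val (k v)].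
rewrite /chromsym (trunc_fps_sum (P := @properb G _) (h := h)).
- by apply: eq_bigr => k _; apply: eq_bigr => v _; rewrite ffunE.
- move=> k k' _ _ /ffunP e; apply/ffunP => v; apply: val_inj.
  by have := e v; rewrite !ffunE.
- move=> k /forallP pk; split.
    by move=> u v uv; rewrite !ffunE; move/forallP/(_ v)/implyP/(_ uv): (pk u).
  by rewrite rmorph_prod; apply: eq_bigr => v _; rewrite ffunE [LHS](trunc_xvar (ltn_ord _)).
(* A colouring that contributes to a low monomial uses only colours below [N]. *)
move=> k m pk /allP low_m /xvar_prodE km.
exists [ffun v => Ordinal (low_m _ (km v))].
  apply/forallP => u; apply/forallP => v; apply/implyP => /pk.
  by rewrite !ffunE.
by apply/ffunP => v; rewrite !ffunE.
Qed.

Lemma sorted_enum_set (A : {set 'I_N}) : sorted ltn [seq val i | i <- enum A].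
Proof.
have -> : [seq val i | i <- enum A] = [seq n <- iota 0 N | n \in [seq val i | i <- enum A]].
  rewrite -(val_enum_ord N) filter_map; congr map.
  rewrite {1}/enum_mem -enumT; apply: eq_in_filter => i _ /=.
  by rewrite mem_map ?mem_enum //; apply: val_inj.
by apply: sorted_filter (iota_ltn_sorted _ _); apply: ltn_trans.
Qed.

Lemma trunc_elemsym n : trunc (elemsym n) =
  \sum_(A : {set 'I_N} | #|A| == n) \prod_(i in A) xvar i.
Proof.
(* Increasing tuples with entries below [N] correspond to subsets of ['I_N]. The default tuple of
   zeros is reached only by sets of the wrong cardinality, which the sum excludes. *)
pose h (A : {set 'I_N}) : n.-tuple nat :=
  insubd (nseq_tuple n 0%N) [seq val i | i <- enum A].
have hE (A : {set 'I_N}) : #|A| == n -> h A = [seq val i | i <- enum A] :> seq nat.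
  by move=> szA; rewrite val_insubd size_map -cardE szA.
have prodE (i : n.-tuple nat) : \prod_(j < n) xvar (tnth i j) = \prod_(c <- i) xvar c.
  by rewrite big_tuple.
rewrite /elemsym (trunc_fps_sum (P := fun A : {set 'I_N} => #|A| == n) (h := h)).
- by apply: eq_bigr => A szA; rewrite prodE hE // big_map big_enum.
- move=> A B szA szB /(congr1 val); rewrite /= !hE // => e.
  apply/setP => i; rewrite -[i \in A]mem_enum -[i \in B]mem_enum.
  by rewrite -!(mem_map val_inj) e.
- move=> A szA; split; first by rewrite /mkset hE // sorted_enum_set.
  rewrite prodE hE // rmorph_prod big_map [RHS]big_map.
  by apply: eq_bigr => i _; rewrite [LHS](trunc_xvar (ltn_ord i)).
move=> i m si /allP low_m /xvar_prodE im.
pose A := [set j : 'I_N | val j \in i].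
have eA : [seq val j | j <- enum A] = i.
  apply: (@irr_sorted_eq _ ltn ltn_trans ltnn) => //; first exact: sorted_enum_set.
  move=> c; apply/mapP/idP => [[j]|]; first by rewrite mem_enum inE => ji ->.
  move=> ci; have /tnthP[j ej] := ci; have := low_m _ (im j); rewrite -ej => lt_c.
  by exists (Ordinal lt_c); rewrite ?mem_enum ?inE.
have szA : #|A| == n by rewrite cardE -(size_map val) eA size_tuple.
by exists A => //; apply: val_inj; rewrite /= hE.
Qed.

Lemma zvarX (R : comNzRingType) n : zvar R ^+ n = fps_monom R n.
Proof. by elim: n => // n IHn; rewrite exprS IHn -fps_monomD. Qed.

Lemma trunc_Eser :
  fps_map trunc Eser = prod_lin (fun i : 'I_N => xvar i).
Proof.
apply: fpsP => n; rewrite /prod_lin.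
(* With the linear term first, the subset in the expansion of the product marks the factors that
   contribute [z], so its cardinality is the exponent. *)
under [in RHS]eq_bigr do rewrite addrC.
rewrite bigA_distr fps_sumE /= trunc_elemsym big_mkcond; apply: eq_bigr => A _ /=.
rewrite -big_mkcond big_split prodr_const zvarX -rmorph_prod fps_constE /= eq_sym.
by case: eqP => _; rewrite ?mulr1 ?mulr0.
Qed.

End Truncation.

(** * Return to infinitely many indeterminates *)

(** Each coefficient is indexed by a monomial in finitely many indeterminates, which is low once [N]
    exceeds their indices. *)
Lemma trunc_inj (M : expoType) (A B : fps xseries M) :
  (forall N, fps_map (trunc N) A = fps_map (trunc N) B) -> A = B.
Proof.
move=> eqAB; apply: fpsP => p; apply: fpsP => m.
pose N := (\max_(i <- (m : xmonom)) i).+1.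
have low_m : low N m by apply/allP => i im; rewrite ltnS; apply: leq_bigmax_seq.
by have := congr1 (fun C : fps xseries M => C p m) (eqAB N); rewrite /= low_m.
Qed.

Lemma trunc_CCser N :
  fps_map (trunc N) CCser = chord_series (fun i : 'I_N => xvar i).
Proof.
apply: fpsP => -[[|a] [|b]] /=; rewrite ?rmorph0 //.
by rewrite -sum_properb_CC trunc_chromsym.
Qed.

Lemma trunc_Fser N (E := prod_lin (fun i : 'I_N => xvar i)) :
  fps_map (trunc N) Fser = E - zvar xseries * fps_deriv E.
Proof.
by rewrite /E -trunc_Eser -fps_map_deriv /zvar -(fps_map_monom (trunc N)) -rmorphM -rmorphB.
Qed.

(** Truncation commutes with the ring operations, differentiation and substitution, so the identity
    follows from [chord_seriesMF] for every [N]. Stating it without quotients avoids transporting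
    inverses. *)
Lemma CCserMF (x := xind xseries) (y := yind xseries) (E := Eser)
    (E' := fps_deriv E) (E'' := fps_deriv E') (F := Fser) :
  (x - y) ^+ 3 * CCser * (at_x F * at_y F) =
  x * y * ((x - y) * (x ^+ 2 * at_x E'' * at_y E + y ^+ 2 * at_y E'' * at_x E)
           - 2%:R * x * y * (at_x E' * at_y F - at_y E' * at_x F)).
Proof.
apply: trunc_inj => N; have := chord_seriesMF (fun i : 'I_N => xvar i); cbv zeta.
rewrite -trunc_CCser -trunc_Fser -trunc_Eser.
rewrite -!fps_map_deriv -!fps_map_at_x -!fps_map_at_y.
have <- : fps_map (trunc N) x = xind xseries by apply: fps_map_monom.
have <- : fps_map (trunc N) y = yind xseries by apply: fps_map_monom.
rewrite -/E -/E' -/E'' -/F; clearbody F.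
by move=> eqN; rewrite !(rmorph_nat, rmorphXn, rmorphM, rmorphN, rmorphD).
Qed.

Theorem theorem4p1 :
  let x := xind xseries in
  let y := yind xseries in
  let E := Eser in
  let E' := fps_deriv E in
  let E'' := fps_deriv E' in
  let F := Fser in
  (x - y) ^+ 3 * CCser =
  x * y *
    ((x - y) * ((x ^+ 2 * at_x E'' * at_y E + y ^+ 2 * at_y E'' * at_x E)
                / (at_x F * at_y F))
     - 2%:R * x * y * (at_x E' / at_x F - at_y E' / at_y F)).
Proof.
move=> x y E E' E'' F.
have [Fx Fy] := (Fser_x_unit, Fser_y_unit).
(* F(x) F(y) is a unit, hence can be cancelled; the rest clears the quotients term by term. *)
apply: (mulIr (rpredM Fx Fy)); rewrite CCserMF -/x -/y -/E -/E' -/E'' -/F.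
rewrite -[RHS]mulrA; congr (_ * _); rewrite [RHS]mulrBl; congr (_ - _).
  by rewrite -[RHS]mulrA divrK ?rpredM.
rewrite -[RHS]mulrA; congr (_ * _); rewrite [RHS]mulrBl; congr (_ - _).
  by rewrite mulrA divrK.
by rewrite [_ * at_y F]mulrC mulrA divrK.
Qed.
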